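(* Let $\nu$ be the uniform probability distribution on $[0,1]$, and for $j\in\mathbb{N}$ let $C_j=\{(x,y)\in\mathbb{R}^2 : -\frac1j\le x\le 1,\ y=x+\frac1j\}$. Let $D(\nu)$ be the constrained quantization dimension of $\nu$ with respect to the family $\{C_j : j\in\mathbb{N}\}$ (which exists and equals $2$). Then the $D(\nu)$-dimensional constrained quantization coefficient for $\nu$ exists, and equals $\frac12$.
   Context: A real number $x$ is identified with $(x,0)\in\mathbb{R}^2$, so $\nu$ is regarded as a Borel probability measure on $\mathbb{R}^2$ supported on $[0,1]\times\{0\}$; $d$ denotes Euclidean distance on $\mathbb{R}^2$. The $n$th constrained quantization error of $\nu$ with respect to $\{C_j\}$ is $$R_n(\nu)=\inf\Big\{\int \min_{a\in\gamma} d(x,a)^2\,d\nu(x) : \gamma\subseteq\bigcup_{j=1}^n C_j,\ 1\le \mathrm{card}(\gamma)\le n\Big\}.$$ When $(R_n(\nu))_n$ is strictly decreasing, put $R_\infty(\nu)=\lim_{n\to\infty}R_n(\nu)$. The constrained quantization dimension of $\nu$ is $D(\nu)=\lim_{n\to\infty}\frac{2\log n}{-\log(R_n(\nu)-R_\infty(\nu))}$, if this limit exists. For $\kappa>0$, the $\kappa$-dimensional constrained quantization coefficient for $\nu$ is $\lim_{n\to\infty} n^{2/\kappa}\,(R_n(\nu)-R_\infty(\nu))$, if this limit exists. *)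

(* Defs.v *)
From HB Require Import structures.
From mathcomp Require Import all_boot all_order all_algebra finmap.
From mathcomp Require Import all_classical all_reals all_analysis.
Import Order.TTheory GRing.Theory Num.Theory.
Import numFieldNormedType.Exports.

Set Implicit Arguments.
Unset Strict Implicit.
Unset Printing Implicit Defensive.

Local Open Scope classical_set_scope.
Local Open Scope ring_scope.

(* The plane is R * R with the product sigma-algebra, which
   is its Borel sigma-algebra.  The library norm on R * R is the sup norm, so
   the Euclidean distance is spelled out. *)
Definition eucl_dist (R : realType) (p q : R * R) : R :=
  Num.sqrt ((p.1 - q.1) ^+ 2 + (p.2 - q.2) ^+ 2).

Section constrained_quantization.
Context (R : realType) (nu : probability (R * R)%type R).
(* Only C 1, C 2, ... matter; C 0 is never used. *)
Variable C : nat -> set (R * R).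

(* The minimum is taken in \bar R, where +oo is neutral; the sets of points
   below are nonempty, so the value is the real minimum. *)
Definition distortion (gamma : {fset R * R}) : \bar R :=
  (\int[nu]_x \big[mine/+oo]_(a <- gamma) (eucl_dist x a ^+ 2)%:E)%E.

Definition admissible (n : nat) : set {fset R * R} :=
  [set gamma | [set` gamma] `<=` \bigcup_(j in [set j | (1 <= j <= n)%N]) C j
             /\ (1 <= #|` gamma| <= n)%N].

Definition cq_error (n : nat) : \bar R :=
  ereal_inf [set distortion gamma | gamma in admissible n].

Definition cq_error_decreasing : Prop :=
  forall m n : nat, (1 <= m < n)%N -> (cq_error n < cq_error m)%E.

Definition cq_error_infty : \bar R := limn cq_error.

(* R_n - R_oo as a real number. *)
Definition cq_excess (n : nat) : R := fine (cq_error n - cq_error_infty)%E.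

(* "the dimension exists and equals D"; R_oo is only defined for a strictly
   decreasing error sequence. *)
Definition is_cq_dimension (D : R) : Prop :=
  cq_error_decreasing /\
  (2 * ln n%:R / - ln (cq_excess n)) @[n --> \oo] --> D.

(* "the kappa-dimensional coefficient exists and equals c" *)
Definition is_cq_coefficient (kappa c : R) : Prop :=
  [/\ 0 < kappa, cq_error_decreasing &
      (n%:R `^ (2 / kappa) * cq_excess n) @[n --> \oo] --> c].

End constrained_quantization.

Definition embed_line (R : realType) (x : measurableTypeR R) : R * R := (x, 0).

Lemma measurable_embed_line (R : realType) :
  measurable_fun [set: measurableTypeR R] (@embed_line R).
Proof. exact: pair2_measurable. Qed.

HB.instance Definition _ (R : realType) :=
  isMeasurableFun.Build _ _ _ _ (@embed_line R) (@measurable_embed_line R).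

Definition uniform01_plane (R : realType) : probability (R * R)%type R :=
  distribution (uniform_prob (@ltr01 R)) (@embed_line R).

Definition segment_family (R : realType) (j : nat) : set (R * R) :=
  [set p | - j%:R^-1 <= p.1 <= 1 /\ p.2 = p.1 + j%:R^-1].

(* Main.v *)
(* For a in C_j the squared distance from (x, 0) to a is
   ((x + 1/j)^2 + (x - t)^2) / 2 with t = a.1 + a.2, so the points should be
   taken on C_n, and what remains is the quantization of the uniform
   distribution on [0, 1] by the values t.  With c = 1/(2n), the minimum of
   (x - t)^2 over n values t is at least
   c^2 - \sum_t max(0, c^2 - (x - t)^2), each term of the sum having integral at
   most 4c^3/3; both bounds are equalities at the midpoints t = (2i + 1)/(2n).
   Hence R_n = 1/6 + 1/(2n) + 13/(24 n^2). *)
Require Import Defs.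
From mathcomp Require Import all_boot all_order all_algebra finmap.
From mathcomp Require Import all_classical all_reals all_analysis.
From mathcomp Require Import measurable_realfun lra.
Import Order.TTheory GRing.Theory Num.Theory.
Import numFieldNormedType.Exports.
Local Open Scope classical_set_scope.
Local Open Scope ring_scope.

(** * Integrals of quadratics and of truncated parabolas *)

Section quadratic_integrals.
Context {R : realType}.
Local Notation mu := (@lebesgue_measure R).

(** One antiderivative centred at [s] serves both the bumps ([s = t]) and the envelope
    ([s = - n%:R^-1]). *)
Lemma integral_quadratic (a b u v s : R) : a < b ->
  (\int[mu]_(x in `[a, b]) (u + v * (x - s) ^+ 2)%:E
   = (u * (b - a) + v / 3 * ((b - s) ^+ 3 - (a - s) ^+ 3))%:E)%E.
Proof.
move=> ab.
pose f (x : R) := u + v * (x - s) ^+ 2.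
pose F (x : R) := u * x + v / 3 * (x - s) ^+ 3.
have dF (x : R) : is_derive x 1 F (f x).
  by rewrite /F /f; apply: is_derive_eq; rewrite /GRing.scale /=; lra.
have cF (x : R) : {for x, continuous F}.
  by apply/differentiable_continuous/derivable1_diffP; have [] := dF x.
have cf : continuous f.
  move=> x; rewrite /f; apply: cvgD; first exact: cvg_cst.
  apply: cvgM; first exact: cvg_cst.
  by rewrite expr2; apply: cvgM; apply: cvgB; first [exact: cvg_id|exact: cvg_cst].
rewrite (@continuous_FTC2 _ f F) //.
- by rewrite -EFinB; congr (_%:E); rewrite /F; lra.
- exact: continuous_subspaceT.
- split.
  + by move=> x _; have [] := dF x.
  + exact/cvg_at_right_filter/cF.
  + exact/cvg_at_left_filter/cF.
- by move=> x _; rewrite derive1E; have [] := dF x.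
Qed.

(** The truncation at 0 makes a sum of bumps dominate each of its terms, and confines each bump to
    the interval of radius [c] about [t]. *)
Definition bump (c t x : R) : R := Num.max 0 (c ^+ 2 - (x - t) ^+ 2).

Lemma bump_ge0 (c t x : R) : 0 <= bump c t x.
Proof. by rewrite /bump le_max lexx. Qed.

Lemma bump_in (c t x : R) : t - c <= x <= t + c -> bump c t x = c ^+ 2 - (x - t) ^+ 2.
Proof. by move=> xtc; rewrite /bump; apply/max_idPr; nra. Qed.

Lemma bump_out (c t x : R) : 0 <= c -> c <= `|x - t| -> bump c t x = 0.
Proof.
move=> c0 cx; rewrite /bump; apply/max_idPl; rewrite subr_le0.
by rewrite -[leRHS]real_normK ?num_real// lerXn2r// nnegrE.
Qed.

Lemma measurable_bump (c t : R) (D : set R) : measurable_fun D (bump c t).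
Proof.
apply: measurable_maxr => //; apply: measurable_funB => //.
by apply: measurable_funX; apply: measurable_funB.
Qed.

Lemma emeasurable_bump (c t : R) (D : set R) :
  measurable_fun D (fun x : R => (bump c t x)%:E).
Proof. by apply/measurable_EFinP; exact: measurable_bump. Qed.

Lemma integral_bump_itv (c t : R) : 0 < c ->
  (\int[mu]_(x in `[(t - c)%R, (t + c)%R]) (bump c t x)%:E = (4 / 3 * c ^+ 3)%:E)%E.
Proof.
move=> c0.
transitivity
  (\int[mu]_(x in `[(t - c)%R, (t + c)%R]) (c ^+ 2 + (- 1) * (x - t) ^+ 2)%:E)%E.
  by apply: eq_integral => x; rewrite inE /= in_itv /= => xtc; rewrite bump_in // mulN1r.
by rewrite integral_quadratic; [congr (_%:E); lra | lra].
Qed.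

Lemma integral_bump_le (c t : R) (A : set R) : 0 < c -> measurable A ->
  (\int[mu]_(x in A) (bump c t x)%:E <= (4 / 3 * c ^+ 3)%:E)%E.
Proof.
move=> c0 mA; rewrite -(integral_bump_itv c t c0).
apply: (@le_trans _ _ (\int[mu]_(x in [set: R]) (bump c t x)%:E)%E).
  apply: ge0_subset_integral => //; first exact: emeasurable_bump.
  by move=> x _; rewrite lee_fin bump_ge0.
(* Outside [[t - c, t + c]] the bump vanishes, so the whole line contributes no more than that
   interval. *)
rewrite [leRHS]integral_mkcond le_eqVlt; apply/orP; left; apply/eqP.
apply: eq_integral => x _; rewrite patchE; case: ifPn => //.
rewrite notin_setE /= in_itv /= => xI.
rewrite bump_out //; first exact: ltW.
rewrite leNgt; apply/negP; rewrite ltr_norml => xtc.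
by apply: xI; lra.
Qed.

Lemma integral_bump_ge (c t : R) (A : set R) : 0 < c -> measurable A ->
  `[t - c, t + c] `<=` A ->
  ((4 / 3 * c ^+ 3)%:E <= \int[mu]_(x in A) (bump c t x)%:E)%E.
Proof.
move=> c0 mA sA; rewrite -(integral_bump_itv c t c0).
apply: ge0_subset_integral => //; first exact: emeasurable_bump.
by move=> x _; rewrite lee_fin bump_ge0.
Qed.

Lemma integral_sum_bump (I : Type) (s : seq I) (t : I -> R) (c : R) (A : set R) :
  measurable A ->
  (\int[mu]_(x in A) (\sum_(i <- s) 1 / 2 * bump c (t i) x)%:E =
   \sum_(i <- s) (1 / 2)%:E * \int[mu]_(x in A) (bump c (t i) x)%:E)%E.
Proof.
move=> mA; under eq_integral do rewrite -sumEFin.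
rewrite ge0_integral_sum//; first last.
- by move=> i x _; rewrite lee_fin mulr_ge0// bump_ge0.
- move=> i; apply/measurable_EFinP/measurable_funM => //.
  exact: measurable_bump.
apply: eq_bigr => i _; under eq_integral do rewrite EFinM.
rewrite ge0_integralZl_EFin//.
- by move=> x _; rewrite lee_fin bump_ge0.
- exact: emeasurable_bump.
Qed.

Lemma measurable_sum_bump (I : Type) (s : seq I) (t : I -> R) (c : R)
    (D : set R) :
  measurable_fun D (fun x : R => (\sum_(i <- s) 1 / 2 * bump c (t i) x)%:E).
Proof.
apply/measurable_EFinP/measurable_sum => i; apply: measurable_funM => //.
exact: measurable_bump.
Qed.

Lemma sum_bump_ge0 (I : Type) (s : seq I) (t : I -> R) (c x : R) :
  0 <= \sum_(i <- s) 1 / 2 * bump c (t i) x.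
Proof. by apply: sumr_ge0 => i _; rewrite mulr_ge0// bump_ge0. Qed.

End quadratic_integrals.

(** * Distortion as an integral over the unit interval *)

Section distortion.
Context {R : realType}.
Local Notation mu := (@lebesgue_measure R).

Lemma eucl_dist_sqr (p q : R * R) :
  eucl_dist p q ^+ 2 = (p.1 - q.1) ^+ 2 + (p.2 - q.2) ^+ 2.
Proof. by rewrite /eucl_dist sqr_sqrtr// addr_ge0// sqr_ge0. Qed.

Lemma measurable_bigmine d (T : measurableType d) (D : set T) (I : Type)
    (s : seq I) (F : I -> T -> \bar R) :
  (forall i, measurable_fun D (F i)) ->
  measurable_fun D (fun x => \big[mine/+oo%E]_(i <- s) F i x).
Proof.
move=> mF; elim: s => [|i s ih].
  by under eq_fun do rewrite big_nil; exact: measurable_cst.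
by under eq_fun do rewrite big_cons; exact: measurable_mine.
Qed.

Lemma measurable_eucl_dist_sqr (a : R * R) :
  measurable_fun [set: R * R] (fun p : R * R => (eucl_dist p a ^+ 2)%:E).
Proof.
under eq_fun do rewrite eucl_dist_sqr.
apply/measurable_EFinP/measurable_funD; apply: measurable_funX;
  exact: measurable_funB.
Qed.

Lemma distortion_uniform (gamma : {fset R * R}) :
  distortion (uniform01_plane R) gamma =
  (\int[mu]_(x in `[0%R, 1%R])
     \big[mine/+oo]_(a <- gamma) (eucl_dist (x, 0%R) a ^+ 2)%:E)%E.
Proof.
pose f (p : R * R) := (\big[mine/+oo]_(a <- gamma) (eucl_dist p a ^+ 2)%:E)%E.
have mf : measurable_fun [set: R * R] f.
  by apply: measurable_bigmine => a; exact: measurable_eucl_dist_sqr.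
have f0 p : (0 <= f p)%E.
  by apply: le_bigmin => [|a _]; rewrite ?leey// lee_fin sqr_ge0.
rewrite /distortion /uniform01_plane ge0_integral_distribution//.
rewrite integral_uniform ?subr0 ?invr1 ?mul1e//.
- by apply: measurableT_comp => //; exact: measurable_embed_line.
- by move=> x; exact: f0.
Qed.

(* The square completed along the line [y = x + h]: the point
   [(x, 0)] projects on the point of the line with [a.1 + a.2 = x]. *)
Lemma eucl_dist_segment (j : nat) (x : R) (a : R * R) : segment_family j a ->
  eucl_dist (x, 0) a ^+ 2 =
  (x + j%:R^-1) ^+ 2 / 2 + (x - (a.1 + a.2)) ^+ 2 / 2.
Proof. by move=> [_ a2]; rewrite eucl_dist_sqr a2 /=; lra. Qed.

Local Notation min_sqr_dist gamma x :=
  (\big[mine/+oo%E]_(a <- gamma) (eucl_dist (x, 0%R) a ^+ 2)%:E).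

Lemma min_sqr_dist_ge0 (gamma : {fset R * R}) (x : R) :
  (0 <= min_sqr_dist gamma x)%E.
Proof. by apply: le_bigmin => [|a _]; rewrite ?leey// lee_fin sqr_ge0. Qed.

Lemma measurable_min_sqr_dist (gamma : {fset R * R}) (D : set R) :
  measurable_fun D (fun x : R => min_sqr_dist gamma x).
Proof.
apply: measurable_bigmine => a; apply: measurable_funTS.
apply: (@measurableT_comp _ _ _ _ _ _ _ _ (@embed_line R)
         (measurable_eucl_dist_sqr a)).
exact: measurable_embed_line.
Qed.

(** * The lower bound on the distortion *)

Definition cq_error_value (n : nat) : R :=
  1 / 6 + n%:R^-1 / 2 + 13 / 24 * n%:R^-1 ^+ 2.

(* [x - - n%:R^-1] puts the integrand in the shape of [integral_quadratic]. *)
Definition envelope (n : nat) (x : R) : R :=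
  (n%:R^-1 / 2) ^+ 2 / 2 + 1 / 2 * (x - - n%:R^-1) ^+ 2.

Lemma envelope_ge0 n x : 0 <= envelope n x.
Proof.
by apply: addr_ge0; [apply: divr_ge0 | apply: mulr_ge0]; rewrite ?sqr_ge0.
Qed.

Lemma measurable_envelope n (D : set R) :
  measurable_fun D (fun x : R => (envelope n x)%:E).
Proof.
apply/measurable_EFinP; apply: measurable_funD => //; apply: measurable_funM => //.
by apply: measurable_funX; exact: measurable_funB.
Qed.

(** The term beside [cq_error_value n] is the mass of [n] whole bumps of weight 1/2. Both bounds on
    the distortion cancel it against an integral of bumps. *)
Lemma integral_envelope n : (0 < n)%N ->
  (\int[mu]_(x in `[0%R, 1%R]) (envelope n x)%:E =
   (cq_error_value n + n%:R * (1 / 2 * (4 / 3 * (n%:R^-1 / 2) ^+ 3)))%:E)%E.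
Proof.
move=> n0; rewrite integral_quadratic//; congr (_%:E).
have nc : n%:R * n%:R^-1 = 1 :> R by rewrite divff// pnatr_eq0 -lt0n.
rewrite (_ : n%:R * _ = (n%:R * n%:R^-1) * (n%:R^-1 ^+ 2 / 12)); last by lra.
by rewrite nc /cq_error_value; lra.
Qed.

(** A point [a] of [C_j] with [j <= n] has [1/j >= 1/n], so for [x >= 0] its height term is at least
    that of [C_n]. Its own bump makes up for any shortfall of [(x - t)^2] below [c^2], and the other
    bumps are nonnegative. *)
Lemma envelope_le (n : nat) (gamma : {fset R * R}) (x : R) : (0 < n)%N ->
  admissible (@segment_family R) n gamma -> 0 <= x ->
  ((envelope n x)%:E <= min_sqr_dist gamma x +
    (\sum_(a <- gamma) 1 / 2 * bump (n%:R^-1 / 2) (a.1 + a.2) x)%:E)%E.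
Proof.
(* With the finite bump sum on the left, the minimum can be bounded below one point at a time. *)
move=> n0 [gammaC _] x0; rewrite -leeBlDr// -EFinB [leRHS]big_seq.
apply: le_bigmin => [|a agamma]; first exact: leey.
have [j /= /andP[j0 jn] aj] := gammaC a agamma.
have jn' : n%:R^-1 <= j%:R^-1 :> R by rewrite lef_pV2 ?posrE ?ltr0n ?ler_nat.
have n0' : 0 < n%:R^-1 :> R by rewrite invr_gt0 ltr0n.
rewrite lee_fin (eucl_dist_segment _ _ _ aj) (big_rem a)//=.
set S := \sum_(_ <- _) _.
have S0 : 0 <= S by exact: sum_bump_ge0.
have : (n%:R^-1 / 2) ^+ 2 - (x - (a.1 + a.2)) ^+ 2
       <= bump (n%:R^-1 / 2) (a.1 + a.2) x by rewrite /bump le_max lexx orbT.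
have : (x + n%:R^-1) ^+ 2 <= (x + j%:R^-1) ^+ 2.
  by rewrite lerXn2r ?nnegrE ?addr_ge0 ?lerD2l// ltW// (lt_le_trans n0').
by rewrite /envelope; lra.
Qed.

Lemma le_distortion (n : nat) (gamma : {fset R * R}) : (0 < n)%N ->
  admissible (@segment_family R) n gamma ->
  ((cq_error_value n)%:E <= distortion (uniform01_plane R) gamma)%E.
Proof.
move=> n0 adm; rewrite distortion_uniform.
have c0 : 0 < n%:R^-1 / 2 :> R by rewrite divr_gt0// invr_gt0 ltr0n.
set K := n%:R * (1 / 2 * (4 / 3 * (n%:R^-1 / 2) ^+ 3)) : R.
(* Adding [K] to both sides turns the goal into the integrated form of [envelope_le]; [K] bounds the
   bump integral since [gamma] has at most [n] points. *)
rewrite -(@leeD2rE _ K%:E)// -EFinD -integral_envelope//.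
set s := enum_fset gamma.
have sumK : (\int[mu]_(x in `[0%R, 1%R])
    (\sum_(a <- s) 1 / 2 * bump (n%:R^-1 / 2) (a.1 + a.2) x)%:E <= K%:E)%E.
  rewrite (integral_sum_bump _ s (fun a : R * R => a.1 + a.2))//.
  apply: (@le_trans _ _
    (\sum_(a <- s) (1 / 2 * (4 / 3 * (n%:R^-1 / 2) ^+ 3))%:E)%E).
    apply: lee_sum => a _; rewrite [leRHS]EFinM; apply: lee_wpmul2l => //.
    exact: integral_bump_le.
  rewrite sumEFin lee_fin big_const_seq count_predT iter_addr_0 /K.
  rewrite -[leLHS]mulr_natl; apply: ler_wpM2r; last rewrite ler_nat.
    by rewrite !mulr_ge0// exprn_ge0// ltW.
  by case: adm => _ /andP[].
apply: le_trans (leeD2l _ sumK); rewrite -ge0_integralD//.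
- apply: ge0_le_integral => //.
  + by move=> x _; rewrite lee_fin envelope_ge0.
  + exact: measurable_envelope.
  + by apply: emeasurable_funD;
      [exact: measurable_min_sqr_dist|exact: measurable_sum_bump].
  + by move=> x; rewrite /= in_itv /= => /andP[x0 _]; exact: envelope_le.
- by move=> x _; exact: min_sqr_dist_ge0.
- exact: measurable_min_sqr_dist.
- by move=> x _; rewrite lee_fin sum_bump_ge0.
- exact: measurable_sum_bump.
Qed.

(** * Optimal sets and the matching upper bound *)

Definition midpoint (n i : nat) : R := (i%:R + 1 / 2) / n%:R.

(** The point of the line [y = x + 1/n] whose coordinates sum to [midpoint n i], that is, the
    projection of [(midpoint n i, 0)] on that line. *)
Definition optimal_point (n i : nat) : R * R :=
  ((midpoint n i - n%:R^-1) / 2, (midpoint n i + n%:R^-1) / 2).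

Definition optimal_set (n : nat) : {fset R * R} :=
  [fset a in [seq optimal_point n i | i <- iota 0 n]]%fset.

Lemma optimal_set_admissible n : (0 < n)%N ->
  admissible (@segment_family R) n (optimal_set n).
Proof.
move=> n0; have n0' : 0 < n%:R^-1 :> R by rewrite invr_gt0 ltr0n.
split.
  move=> a /=; rewrite inE => /mapP[i]; rewrite mem_iota add0n => /= i_n ->.
  exists n => /=; first by rewrite n0 leqnn.
  have nc : n%:R * n%:R^-1 = 1 :> R by rewrite divff// pnatr_eq0 -lt0n.
  have in' : i%:R + 1 <= n%:R :> R by rewrite natr1 ler_nat.
  have i0 : 0 <= i%:R :> R by [].
  rewrite /segment_family /= /midpoint; split; last by lra.
  by apply/andP; split; nra.
apply/andP; split.
  rewrite cardfs_gt0; apply/fset0Pn; exists (optimal_point n 0).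
  by rewrite inE; apply/map_f; rewrite mem_iota.
rewrite card_fseq (leq_trans (size_undup _))// size_map size_iota//.
Qed.

(** The cells of length [1/n] about the midpoints cover the unit interval. In the cell of [k] only
    the bump of [k] survives, and there the point of index [k] alone gives exactly the envelope. *)
Lemma optimal_set_le n (x : R) : (0 < n)%N -> 0 <= x <= 1 ->
  (min_sqr_dist (optimal_set n) x +
    (\sum_(i <- iota 0 n) 1 / 2 * bump (n%:R^-1 / 2) (midpoint n i) x)%:E
  <= (envelope n x)%:E)%E.
Proof.
move=> n0 /andP[x0 x1]; have n0' : 0 < n%:R^-1 :> R by rewrite invr_gt0 ltr0n.
have nc : n%:R * n%:R^-1 = 1 :> R by rewrite divff// pnatr_eq0 -lt0n.
have [k kn /andP[kx xk]] : exists2 k, (k < n)%N & k%:R <= n%:R * x <= k%:R + 1.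
  have nx0 : 0 <= n%:R * x by rewrite mulr_ge0.
  have /andP[tx xt] := truncn_itv nx0.
  have [tn|nt] := ltnP (Num.truncn (n%:R * x)) n.
    by exists (Num.truncn (n%:R * x)) => //; rewrite tx natr1 ltW.
  (* This case forces [x = 1], the right end of the last cell. *)
  exists n.-1; first by rewrite prednK.
  have nE : n.-1%:R + 1 = n%:R :> R by rewrite natr1 prednK.
  have : n%:R <= (Num.truncn (n%:R * x))%:R :> R by rewrite ler_nat.
  have : n%:R * x <= n%:R by rewrite ler_piMr.
  by move: nE tx; lra.
have xE : x = (n%:R * x) * n%:R^-1 by rewrite mulrAC nc mul1r.
have xmid : midpoint n k - n%:R^-1 / 2 <= x <= midpoint n k + n%:R^-1 / 2.
  by rewrite xE /midpoint; apply/andP; split; nra.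
(* Distinct midpoints are at least [1/n] apart and [x] is within [1/(2n)] of that of [k]. *)
have far i : i != k -> bump (n%:R^-1 / 2) (midpoint n i) x = 0.
  move=> ik; apply: bump_out; first by lra.
  have [ltik|ltki|/eqP] := ltngtP i k; last by rewrite (negbTE ik).
    rewrite ler_normr; apply/orP; left.
    have : i%:R + 1 <= k%:R :> R by rewrite natr1 ler_nat.
    by rewrite xE /midpoint; nra.
  rewrite ler_normr; apply/orP; right.
  have : k%:R + 1 <= i%:R :> R by rewrite natr1 ler_nat.
  by rewrite xE /midpoint; nra.
have -> : \sum_(i <- iota 0 n) 1 / 2 * bump (n%:R^-1 / 2) (midpoint n i) x
          = 1 / 2 * bump (n%:R^-1 / 2) (midpoint n k) x.
  rewrite (bigD1_seq k) ?iota_uniq ?mem_iota//= big1 ?addr0// => i ik.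
  by rewrite far// mulr0.
rewrite -leeBrDr// -EFinB.
have kin : optimal_point n k \in optimal_set n.
  by rewrite inE; apply/map_f; rewrite mem_iota.
apply: (bigmin_inf_seq _ _ _ _ _ kin) => //; rewrite lee_fin bump_in//.
by rewrite eucl_dist_sqr /envelope /=; lra.
Qed.

Lemma distortion_optimal_set n : (0 < n)%N ->
  (distortion (uniform01_plane R) (optimal_set n) <= (cq_error_value n)%:E)%E.
Proof.
move=> n0; rewrite distortion_uniform.
have c0 : 0 < n%:R^-1 / 2 :> R by rewrite divr_gt0// invr_gt0 ltr0n.
set K := n%:R * (1 / 2 * (4 / 3 * (n%:R^-1 / 2) ^+ 3)) : R.
rewrite -(@leeD2rE _ K%:E)// -EFinD -integral_envelope//.
have nc : n%:R * n%:R^-1 = 1 :> R by rewrite divff// pnatr_eq0 -lt0n.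
have sumK : (K%:E <= \int[mu]_(x in `[0%R, 1%R])
    (\sum_(i <- iota 0 n) 1 / 2 * bump (n%:R^-1 / 2) (midpoint n i) x)%:E)%E.
  rewrite integral_sum_bump//.
  apply: (@le_trans _ _
    (\sum_(i <- iota 0 n) (1 / 2 * (4 / 3 * (n%:R^-1 / 2) ^+ 3))%:E)%E).
    rewrite sumEFin lee_fin big_const_seq count_predT iter_addr_0 /K.
    by rewrite size_iota -[leRHS]mulr_natl.
  rewrite big_seq [leRHS]big_seq.
  apply: lee_sum => i; rewrite mem_iota /= add0n => i_n.
  (* The support of bump [i] is [[i/n, (i+1)/n]], inside the unit interval, so no mass is lost. *)
  rewrite [leLHS]EFinM; apply: lee_wpmul2l => //; apply: integral_bump_ge => // x.
  have in' : i%:R + 1 <= n%:R :> R by rewrite natr1 ler_nat.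
  have i0 : 0 <= i%:R :> R by [].
  rewrite /= !in_itv /= /midpoint => /andP[ix xi].
  by apply/andP; split; nra.
apply: le_trans (leeD2l _ sumK) _; rewrite -ge0_integralD//.
- apply: ge0_le_integral => //.
  + by move=> x _; rewrite adde_ge0 ?min_sqr_dist_ge0 ?lee_fin ?sum_bump_ge0.
  + by apply: emeasurable_funD;
      [exact: measurable_min_sqr_dist|exact: measurable_sum_bump].
  + exact: measurable_envelope.
  + by move=> x; rewrite /= in_itv /= => ?; exact: optimal_set_le.
- by move=> x _; exact: min_sqr_dist_ge0.
- exact: measurable_min_sqr_dist.
- by move=> x _; rewrite lee_fin sum_bump_ge0.
- exact: measurable_sum_bump.
Qed.

Lemma cq_error_uniform n : (0 < n)%N ->
  cq_error (uniform01_plane R) (@segment_family R) n = (cq_error_value n)%:E.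
Proof.
move=> n0; apply/eqP; rewrite eq_le; apply/andP; split.
  apply: ge_ereal_inf; exists (distortion (uniform01_plane R) (optimal_set n)).
    by exists (optimal_set n) => //; exact: optimal_set_admissible.
  exact: distortion_optimal_set.
by apply: le_ereal_inf_tmp => _ [gamma adm <-]; exact: le_distortion.
Qed.

End distortion.

(** * Limits: the error at infinity, the dimension and the coefficient *)

Section asymptotics.
Context {R : realType}.
Local Notation excess := (cq_excess (uniform01_plane R) (@segment_family R)).
Local Notation scaled_excess := (fun n : nat => 1 / 2 + 13 / 24 * n%:R^-1 : R).

Lemma cvg_natrV : (n%:R^-1 : R) @[n --> \oo] --> (0 : R).
Proof. by rewrite -(cvg_shiftS (fun n : nat => n%:R^-1 : R)); exact: cvg_harmonic. Qed.

Lemma cvg_ln_natrV : (ln n%:R)^-1 @[n --> \oo] --> (0 : R).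
Proof.
apply/gtr0_cvgV0.
  by near=> n; rewrite ln_gt0// ltr1n; near: n; exact: nbhs_infty_gt.
apply/cvgryPgt => A; near=> n.
have An : expR A < n%:R :> R by near: n; exact: nbhs_infty_gtr.
by rewrite -[A]expRK ltr_ln// posrE ?expR_gt0// (lt_trans _ An) ?expR_gt0.
Unshelve. all: by end_near. Qed.

Lemma cvg_scaled_excess : scaled_excess n @[n --> \oo] --> (1 / 2 : R).
Proof.
rewrite -[X in _ --> X]addr0 -[X in _ --> _ + X](mulr0 (13 / 24)).
apply: cvgD; first exact: cvg_cst.
by apply: cvgM; [exact: cvg_cst|exact: cvg_natrV].
Qed.

Lemma cvg_cq_error_value : (cq_error_value n : R) @[n --> \oo] --> (1 / 6 : R).
Proof.
rewrite [X in _ --> X](_ : _ = 1 / 6 + 0 * (1 / 2)); last by lra.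
rewrite [X in X @ _](_ : _ = fun n => 1 / 6 + n%:R^-1 * scaled_excess n); last first.
  by apply/funext => n; rewrite /cq_error_value; lra.
apply: cvgD; first exact: cvg_cst.
by apply: cvgM; [exact: cvg_natrV|exact: cvg_scaled_excess].
Qed.

Lemma cq_error_uniform_decreasing :
  cq_error_decreasing (uniform01_plane R) (@segment_family R).
Proof.
move=> m n /andP[m0 mn]; have n0 : (0 < n)%N by exact: ltn_trans mn.
rewrite !cq_error_uniform// lte_fin /cq_error_value.
have : n%:R^-1 < m%:R^-1 :> R by rewrite ltf_pV2 ?posrE ?ltr0n// ltr_nat.
have : 0 < n%:R^-1 :> R by rewrite invr_gt0 ltr0n.
by move=> ? ?; nra.
Qed.

Lemma cq_error_infty_uniform :
  cq_error_infty (uniform01_plane R) (@segment_family R) = (1 / 6)%:E.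
Proof.
apply/cvg_lim => //; apply: (@cvg_trans _ ((cq_error_value n)%:E @[n --> \oo])).
  (* The closed form holds from [n = 1] on; at [n = 0] no set is admissible and the infimum is
     [+oo]. *)
  apply: near_eq_cvg; near=> n; rewrite cq_error_uniform//.
  by near: n; exact: nbhs_infty_gt.
by apply: cvg_EFin; [exact: nearW|exact: cvg_cq_error_value].
Unshelve. all: by end_near. Qed.

Lemma cq_excess_uniform n : (0 < n)%N -> excess n = n%:R^-1 * scaled_excess n.
Proof.
move=> n0; rewrite /cq_excess cq_error_uniform// cq_error_infty_uniform -EFinB /=.
by rewrite /cq_error_value; lra.
Qed.

Lemma is_cq_dimension_uniform :
  is_cq_dimension (uniform01_plane R) (@segment_family R) 2.
Proof.
split; first exact: cq_error_uniform_decreasing.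
(* Since [- ln (excess n) = ln n - ln (scaled_excess n)], this is the dimension quotient with
   numerator and denominator divided by [ln n], which is nonzero for [n > 1]. *)
pose f (n : nat) : R := 2 / (1 - ln (scaled_excess n) * (ln n%:R)^-1).
have : f n @[n --> \oo] --> 2 / (1 - ln (1 / 2) * 0 : R).
  apply: cvgM; first exact: cvg_cst.
  apply: cvgV; first by rewrite mulr0 subr0 oner_neq0.
  apply: cvgB; first exact: cvg_cst.
  apply: cvgM; last exact: cvg_ln_natrV.
  by apply: continuous_cvg cvg_scaled_excess; apply: continuous_ln; lra.
rewrite mulr0 subr0 divr1 => cf; apply: cvg_trans cf.
apply: near_eq_cvg; near=> n.
have n1 : (1 < n)%N by near: n; exact: nbhs_infty_gt.
have n0 : 0 < n%:R :> R by rewrite ltr0n ltnW.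
have nV0 : 0 < n%:R^-1 :> R by rewrite invr_gt0.
have u0 : 0 < scaled_excess n :> R by lra.
have ln0 : ln n%:R != 0 :> R by rewrite gt_eqF// ln_gt0// ltr1n.
rewrite cq_excess_uniform 1?ltnW// lnM ?posrE// lnV ?posrE// opprD opprK.
rewrite /f -[X in X - _ * _](divff ln0) -mulrBl invf_div mulrA.
Unshelve. all: by end_near. Qed.

Lemma is_cq_coefficient_uniform :
  is_cq_coefficient (uniform01_plane R) (@segment_family R) 2 (1 / 2).
Proof.
split; [by []|exact: cq_error_uniform_decreasing|].
apply: cvg_trans cvg_scaled_excess; apply: near_eq_cvg; near=> n.
have n0 : (0 < n)%N by near: n; exact: nbhs_infty_gt.
(* For [kappa = 2] the power of [n] is [n] itself, which cancels the factor [n%:R^-1] of the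
   excess. *)
rewrite divff// powRr1// cq_excess_uniform// mulrA divff ?mul1r//.
by rewrite pnatr_eq0 -lt0n.
Unshelve. all: by end_near. Qed.

End asymptotics.

Theorem theorem3p8 (R : realType) :
  exists D : R,
    [/\ is_cq_dimension (uniform01_plane R) (@segment_family R) D,
        D = 2 &
        is_cq_coefficient (uniform01_plane R) (@segment_family R) D (1 / 2)].
Proof.
by exists 2; split; [exact: is_cq_dimension_uniform|
  |exact: is_cq_coefficient_uniform].
Qed.
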